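(* Fix any $\epsilon\in(0,\frac12)$ and $\eta\in(0,1)$. Then any transitive linear code $C\subseteq\mathbb{F}_2^N$ of dimension $\dim C=\eta N$ can with high probability list-decode $\epsilon$-errors using a list $T$ of size $|T|=2^{\epsilon N\log_2(\frac{2}{1-\eta})+o(N)}+2^{4\epsilon N+o(N)}$. Explicitly: there are functions $k(N)=2^{\epsilon N\log_2(\frac{2}{1-\eta})+o(N)}+2^{4\epsilon N+o(N)}$ and $p(N)\to0$ as $N\to\infty$, depending only on $\epsilon$ and $\eta$, such that for every transitive linear code $C\subseteq\mathbb{F}_2^N$ with $\dim C=\eta N$ there is a map $T$ assigning to each $x\in\mathbb{F}_2^N$ a subset $T(x)\subseteq C$ with $|T(x)|\leq k(N)$, such that for every $c\in C$, $\Pr_{\rho\sim P_\epsilon}[c\notin T(c+\rho)]\leq p(N)$.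
   Context: $P_\epsilon$ is the distribution on $\mathbb{F}_2^N$ given by $P_\epsilon(z)=\epsilon^{\mathrm{wt}(z)}(1-\epsilon)^{N-\mathrm{wt}(z)}$, where $\mathrm{wt}$ is Hamming weight. A linear code is a linear subspace of $\mathbb{F}_2^N$. A code $C\subseteq\mathbb{F}_2^N$ is transitive if for all $i,j\in\{1,\dots,N\}$ there is a permutation $\pi$ of $\{1,\dots,N\}$ with $\pi(i)=j$ such that $(v_{\pi(1)},\dots,v_{\pi(N)})\in C$ for every $(v_1,\dots,v_N)\in C$. *)

(* Defs.v *)
From mathcomp Require Import all_boot all_order all_algebra all_fingroup.
From mathcomp Require Import all_classical all_reals all_analysis.

Set Implicit Arguments.
Unset Strict Implicit.
Unset Printing Implicit Defensive.

Import Order.TTheory GRing.Theory Num.Theory.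
Import numFieldNormedType.Exports.

Local Open Scope ring_scope.

Definition wt (N : nat) (z : 'rV['F_2]_N) : nat := #|[pred i | z 0 i != 0]|.

Definition Peps (R : realType) (eps : R) (N : nat) (z : 'rV['F_2]_N) : R :=
  eps ^+ wt z * (1 - eps) ^+ (N - wt z).

Definition prob (R : realType) (eps : R) (N : nat)
    (E : pred 'rV['F_2]_N) : R :=
  \sum_(rho | E rho) Peps eps rho.

(* [col_perm s v] is the row vector (v_{s(1)}, ..., v_{s(N)}). *)
Definition transitive_code (N : nat) (C : {vspace 'rV['F_2]_N}) : Prop :=
  forall i j : 'I_N, exists s : 'S_N,
    s i = j /\ forall v : 'rV['F_2]_N, v \in C -> col_perm s v \in C.

Definition log2 (R : realType) (x : R) : R := ln x / ln 2.

(* Main.v *)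
(* Let A = (1 + eta) / (1 - eta) and q^2 = eps / ((1 - eps) A). The decoder lists
   the codewords at typical distance from the received word, unless there are
   too many. By Markov it suffices to bound the sum of q^(wt v + wt (v + c)) over
   all v and all c in C. By Fourier analysis this is at most the average over y
   in the dual code of prod_i (1 + q (-1)^(y_i))^2. An information set of the dual
   code, of size r = N - dim C, carries uniform bits of y, and its images under
   Aut C cover the coordinates evenly, so AM-GM gives the Hölder-type bound
   (E_b (1 + q (-1)^b)^(2N/r))^r. The two-point inequality then yields
   (1 + A q^2)^N = (1 - eps)^(-N), that is, lists of size A^(eps N + o(N)), and
   A <= 2 / (1 - eta), so the first summand of the list size suffices. *)

Require Import Defs.
From mathcomp Require Import all_boot all_order all_algebra all_fingroup.
From mathcomp Require Import all_classical all_reals all_analysis.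
From mathcomp Require Import ring lra.

Set Implicit Arguments.
Unset Strict Implicit.
Unset Printing Implicit Defensive.

Import Order.TTheory GRing.Theory Num.Theory.
Import numFieldNormedType.Exports.

Local Open Scope classical_set_scope.
Local Open Scope ring_scope.

(** * Calculus behind the two-point inequality *)

Lemma le_of_is_derive_ge0 (R : realType) (f f' : R -> R) (b : R) :
    0 <= b ->
    (forall x, 0 <= x -> x <= b -> is_derive x 1 f (f' x)) ->
    (forall x, 0 <= x -> x <= b -> 0 <= f' x) ->
  f 0 <= f b.
Proof.
move=> b0 df f'0.
have dfx x : x \in `[0, b] -> derivable f x 1.
  by rewrite in_itv /= => /andP[x0 xb]; have [] := df x x0 xb.
apply: (@ger0_derive1_ndecr _ f 0 b) => // [x|x|].
- by move=> xb; apply: dfx; apply: subset_itv_oo_cc.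
- rewrite in_itv /= => /andP[/ltW x0 /ltW xb].
  by have fx := df x x0 xb; rewrite derive1E derive_val f'0.
- exact: derivable_within_continuous.
Qed.

Lemma is_derive_affine (R : realType) (c s x : R) :
  is_derive x 1 (fun t => c + s * t) s.
Proof. by apply: is_derive_eq; rewrite add0r mul1r /GRing.scale /= mulr1. Qed.

Lemma is_derive_powR_affine (R : realType) (a s x : R) : 0 < 1 + s * x ->
  is_derive x 1 (fun t => (1 + s * t) `^ a) (a * (1 + s * x) `^ (a - 1) * s).
Proof.
move=> sx.
apply: (@is_derive1_comp _ (fun t => t `^ a) (fun t => 1 + s * t)).
  exact: is_derive1_powR.
exact: is_derive_affine.
Qed.

Lemma powR_succ (R : realType) (x a : R) : 0 < x -> x `^ (a + 1) = x `^ a * x.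
Proof. by move=> x0; rewrite powRD ?powRr1 ?ltW//; apply/implyP => _; rewrite gt_eqF. Qed.

(** Up to a positive factor this is the derivative of the log-ratio in [two_point_le], with
    [n = a - 1]. It vanishes at 0, and its own derivative n(n+1)x((1+x)^(n-1) - (1-x)^(n-1)) is
    nonnegative because [n >= 1]. *)
Lemma two_point_derivative_ge0 (R : realType) (n q : R) : 1 <= n -> 0 <= q < 1 ->
  0 <= (1 + q) `^ n * (n * q - 1) + (1 - q) `^ n * (n * q + 1).
Proof.
move=> n1 /andP[q0 q1].
pose g s (x : R) := (1 + s * x) `^ n * (n * x - s).
pose g' s (x : R) := n * (n + 1) * (x * (s * (1 + s * x) `^ (n - 1))).
have dg (s x : R) : s * s = 1 -> 0 < 1 + s * x -> is_derive x 1 (g s) (g' s x).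
  move=> ss sx.
  have dh : is_derive x 1 (fun t => n * t - s) n.
    rewrite (_ : (fun t => _) = (fun t => - s + n * t)).
      exact: is_derive_affine.
    by apply/funext => t; rewrite addrC.
  apply: (is_derive_eq (is_deriveM (is_derive_powR_affine n sx) dh)).
  rewrite /GRing.scale /= /g'.
  have -> : (1 + s * x) `^ n = (1 + s * x) `^ (n - 1) * (1 + s * x).
    by rewrite -powR_succ ?subrK.
  set u := (1 + s * x) `^ (n - 1).
  transitivity (n * (n + 1) * (x * (s * u)) + n * u * (1 - s * s)); first by ring.
  by rewrite ss subrr mulr0 addr0.
have : g 1 0 + g (-1) 0 <= g 1 q + g (-1) q.
  apply: (@le_of_is_derive_ge0 R (g 1 \+ g (-1)) (g' 1 \+ g' (-1))) => //.
  - move=> x x0 xq; apply: is_deriveD; apply: dg.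
    1-4: by rewrite ?mulrNN ?mul1r ?mulN1r //; lra.
  - move=> x x0 xq; rewrite /= -mulrDr mulr_ge0 ?mulr_ge0; try lra.
    rewrite -mulrDr mulr_ge0 // !mul1r !mulN1r subr_ge0.
    by apply: ge0_ler_powR; rewrite ?nnegrE; lra.
by rewrite /g !mulr0 !addr0 powR1 !mul1r !mulN1r !sub0r opprK addNr.
Qed.

(* Bonami's two-point inequality for the pair of exponents (2, a). *)
Lemma two_point_le (R : realType) (a q : R) : 2 <= a -> 0 <= q < 1 ->
  ((1 + q) `^ a + (1 - q) `^ a) / 2 <= (1 + (a - 1) * q ^+ 2) `^ (a / 2).
Proof.
move=> a2 /andP[q0 q1].
pose S (x : R) := (1 + 1 * x) `^ a + (1 + -1 * x) `^ a.
pose S' (x : R) := a * (1 + 1 * x) `^ (a - 1) * 1 + a * (1 + -1 * x) `^ (a - 1) * -1.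
pose V (x : R) := 1 + (a - 1) * x ^+ 2.
have Spos (x : R) : 0 <= x -> x < 1 -> 0 < S x.
  by move=> x0 x1; rewrite addr_gt0// powR_gt0; lra.
have Vpos (x : R) : 0 < V x by rewrite /V ltr_wpDr// mulr_ge0 ?sqr_ge0; lra.
have dS (x : R) : 0 <= x -> x < 1 -> is_derive x 1 S (S' x).
  by move=> x0 x1; apply: is_deriveD; apply: is_derive_powR_affine; lra.
have dV (x : R) : is_derive x 1 V ((a - 1) * (2 * x)).
  by apply: is_derive_eq; rewrite /GRing.scale /=; ring.
(* The logarithm of the ratio of the two sides, up to the constant ln 2, is shown to be
   nondecreasing from its value at 0. *)
have dL (x : R) : 0 <= x -> x < 1 ->
    is_derive x 1 (fun t => a / 2 * ln (V t) - ln (S t))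
      (a / 2 * ((V x)^-1 * ((a - 1) * (2 * x))) - (S x)^-1 * S' x).
  move=> x0 x1; apply: is_deriveB.
    exact: (is_deriveZ (a / 2) (is_derive1_comp (is_derive1_ln (Vpos x)) (dV x))).
  exact: (is_derive1_comp (is_derive1_ln (Spos x x0 x1)) (dS x x0 x1)).
have L0 : a / 2 * ln (V 0) - ln (S 0) = - ln 2.
  by rewrite /V /S !mulr0 !addr0 powR1 expr0n mulr0 addr0 ln1 mulr0 sub0r.
have : - ln 2 <= a / 2 * ln (V q) - ln (S q).
  rewrite -L0.
  apply: (@le_of_is_derive_ge0 R (fun t => a / 2 * ln (V t) - ln (S t))
    (fun x => a / 2 * ((V x)^-1 * ((a - 1) * (2 * x))) - (S x)^-1 * S' x) q q0)
    => [x x0 xq|x x0 xq].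
    by apply: dL => //; apply: le_lt_trans q1.
  have x1 : x < 1 by apply: le_lt_trans q1.
  have n1 : 1 <= a - 1 by lra.
  have x01 : 0 <= x < 1 by rewrite x0.
  have := two_point_derivative_ge0 n1 x01.
  have SE : S x = (1 + x) `^ (a - 1) * (1 + x) + (1 - x) `^ (a - 1) * (1 - x).
    by rewrite -!powR_succ; [rewrite !subrK /S mul1r mulN1r|lra|lra].
  rewrite /S' mul1r mulN1r.
  set u := (1 + x) `^ (a - 1) in SE *; set v := (1 - x) `^ (a - 1) in SE *.
  move=> uv.
  (* Over the common denominator the quadratic terms cancel, leaving the expression of
     [two_point_derivative_ge0]. *)
  have -> : a / 2 * ((V x)^-1 * ((a - 1) * (2 * x))) - (S x)^-1 * (a * u * 1 + a * v * -1)
      = a * ((V x)^-1 * (S x)^-1) * (u * ((a - 1) * x - 1) + v * ((a - 1) * x + 1)).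
    have Sn : S x != 0 by rewrite gt_eqF ?Spos.
    have Vn : V x != 0 by rewrite gt_eqF.
    rewrite SE in Sn *; rewrite /V in Vn *; field.
    by rewrite Sn Vn.
  rewrite !mulr_ge0 ?invr_ge0 ?(ltW (Spos _ _ _)) ?(ltW (Vpos _)) //; lra.
have Vq := Vpos q; have Sq := Spos q q0 q1.
rewrite (_ : (1 + q) `^ a + (1 - q) `^ a = S q); last by rewrite /S mul1r mulN1r.
rewrite -/(V q) -ler_ln ?posrE ?divr_gt0 ?powR_gt0// ln_powR ln_div ?posrE//.
lra.
Qed.

(** * Product formulas and characters on F_2^n *)

Lemma sum_rV_prod (S : comPzSemiRingType) (T : finType) (n : nat)
    (F : 'I_n -> T -> S) :
  \sum_(v : 'rV[T]_n) \prod_i F i (v 0 i) = \prod_i \sum_b F i b.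
Proof.
rewrite bigA_distr_bigA (reindex (fun f : {ffun 'I_n -> T} => \row_i f i)) /=.
  by apply: eq_bigr => f _; apply: eq_bigr => i _; rewrite mxE.
exists (fun v : 'rV[T]_n => [ffun i => v 0 i]) => x _.
  by apply/ffunP => i; rewrite ffunE mxE.
by apply/rowP => i; rewrite mxE ffunE.
Qed.

Lemma sum_F2 (V : nmodType) (h : 'F_2 -> V) : \sum_b h b = h 0 + h 1.
Proof.
rewrite big_ord_recl big_ord1; congr (h _ + h _); exact: val_inj.
Qed.

Lemma F2P (b : 'F_2) : b = 0 \/ b = 1.
Proof. by case: b => -[|[|//]] i; [left|right]; apply: val_inj. Qed.

Section Signs.
Variable R : realType.

Definition sgF2 (b : 'F_2) : R := if b == 0 then 1 else -1.

Lemma sgF2D a b : sgF2 (a + b) = sgF2 a * sgF2 b.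
Proof.
by case: (F2P a) => ->; case: (F2P b) => ->; rewrite /sgF2 /= ?mulrNN ?mul1r ?mulr1.
Qed.

Lemma sgF2_sum (I : finType) (F : I -> 'F_2) :
  sgF2 (\sum_i F i) = \prod_i sgF2 (F i).
Proof. by apply: (big_morph _ sgF2D); rewrite /sgF2 eqxx. Qed.

Definition chi n (v y : 'rV['F_2]_n) : R := sgF2 ((v *m y^T) 0 0).

Lemma chi_prod n (v y : 'rV['F_2]_n) :
  chi v y = \prod_i sgF2 (v 0 i * y 0 i).
Proof.
rewrite /chi mxE sgF2_sum; apply: eq_bigr => i _; by rewrite mxE.
Qed.

Lemma chiD n (v w y : 'rV['F_2]_n) : chi (v + w) y = chi v y * chi w y.
Proof. by rewrite /chi mulmxDl mxE sgF2D. Qed.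

Lemma expr_wt n (x : R) (v : 'rV['F_2]_n) :
  x ^+ wt v = \prod_i (if v 0 i == 0 then 1 else x).
Proof.
rewrite /wt -prodr_const [LHS]big_mkcond /=.
by apply: eq_bigr => i _; rewrite inE; case: eqP.
Qed.

Lemma Peps_prod n (eps : R) (v : 'rV['F_2]_n) :
  Peps eps v = \prod_i (if v 0 i == 0 then 1 - eps else eps).
Proof.
rewrite /Peps (_ : (n - wt v)%N = #|[pred i | v 0 i == 0]|); last first.
  rewrite /wt -[X in (X - _)%N]card_ord -(cardC [pred i | v 0 i != 0]) addKn.
  by apply: eq_card => i; rewrite !inE negbK.
rewrite expr_wt -prodr_const [X in _ * X]big_mkcond -big_split /=.
by apply: eq_bigr => i _; rewrite inE; case: eqP; rewrite ?mul1r ?mulr1.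
Qed.

(** Fourier transform of x^wt: the weight factor and the character are both products over
    coordinates, so the sum factorises. *)
Lemma sum_expr_wt_chi n (x : R) (y : 'rV['F_2]_n) :

  \sum_v x ^+ wt v * chi v y = \prod_i (1 + x * sgF2 (y 0 i)).
Proof.
under [LHS]eq_bigr => v _ do rewrite expr_wt chi_prod -big_split /=.
rewrite (sum_rV_prod (fun i b => (if b == 0 then 1 else x) * sgF2 (b * y 0 i))).
by apply: eq_bigr => i _; rewrite sum_F2 /= mul0r mul1r mul1r.
Qed.

(** The sum factorises over the entries of [u] into factors 0 or 2. Nonnegativity is what allows a
    sum over a code to be enlarged to the whole space. *)
Lemma sum_chi_ge0 m n (K : 'M['F_2]_(m, n)) (v : 'rV['F_2]_n) :
  0 <= \sum_(u : 'rV_m) chi v (u *m K).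
Proof.
have E u : chi v (u *m K) = \prod_a sgF2 (u 0 a * (v *m K^T) 0 a).
  rewrite /chi trmx_mul mulmxA mxE sgF2_sum; apply: eq_bigr => i _.
  by rewrite [u^T _ _]mxE mulrC.
under eq_bigr => u _ do rewrite E.
rewrite (sum_rV_prod (fun a b => sgF2 (b * (v *m K^T) 0 a))) prodr_ge0 // => a _.
rewrite sum_F2 mul0r mul1r.
by case: (F2P ((v *m K^T) 0 a)) => ->; rewrite /sgF2 /=; lra.
Qed.

(** * Concentration of the weight of the noise *)

Section Noise.
Variables (eps : R) (heps : 0 <= eps <= 1).

Lemma Peps_ge0 n (v : 'rV['F_2]_n) : 0 <= Peps eps v.
Proof. by case/andP: heps => ? ?; rewrite mulr_ge0 // exprn_ge0 //; lra. Qed.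

Lemma Peps_sum1 n : \sum_(v : 'rV_n) Peps eps v = 1.
Proof.
under [LHS]eq_bigr => v _ do rewrite Peps_prod.
rewrite (sum_rV_prod (fun _ b => if b == 0 then 1 - eps else eps)).
by rewrite big1 // => i _; rewrite sum_F2 /=; ring.
Qed.

Lemma wt_variance n :
  \sum_(v : 'rV['F_2]_n) Peps eps v * ((wt v)%:R - eps * n%:R) ^+ 2 <= n%:R.
Proof.
pose mu (b : 'F_2) : R := if b == 0 then 1 - eps else eps.
pose g (b : 'F_2) : R := if b == 0 then - eps else 1 - eps.
have nE : n%:R = \sum_(i < n) (1 : R) by rewrite sumr_const card_ord.
have wtE (v : 'rV['F_2]_n) : (wt v)%:R - eps * n%:R = \sum_i g (v 0 i).
  rewrite /wt -sum1_card natr_sum nE mulr_sumr big_mkcond -sumrB /=.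
  by apply: eq_bigr => i _; rewrite inE /g; case: eqP => _ /=; ring.
(* Factor of coordinate [l] in the (i,j) term of the expanded square. Off the diagonal, the factor
   at [l = i] is the mean of the centred [g], hence 0; on the diagonal all factors are at most 1. *)
pose F (i j l : 'I_n) b :=
  mu b * (if l == i then g b else 1) * (if l == j then g b else 1).
have pick1 (i : 'I_n) (v : 'rV['F_2]_n) :
    \prod_l (if l == i then g (v 0 l) else 1) = g (v 0 i).
  by rewrite -big_mkcond big_pred1_eq.
have -> : \sum_(v : 'rV['F_2]_n) Peps eps v * ((wt v)%:R - eps * n%:R) ^+ 2
    = \sum_i \sum_j \prod_l \sum_b F i j l b.
  under eq_bigr => v _.
    rewrite wtE expr2 mulr_suml mulr_sumr.
    under eq_bigr => i _ do rewrite mulr_sumr mulr_sumr.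
    over.
  rewrite exchange_big; apply: eq_bigr => i _ /=.
  rewrite exchange_big; apply: eq_bigr => j _ /=.
  rewrite -sum_rV_prod; apply: eq_bigr => v _.
  by rewrite !big_split /= !pick1 Peps_prod mulrA.
rewrite nE; apply: ler_sum => i _.
rewrite (bigD1 i) //= [X in _ + X]big1 ?addr0 => [|j ji].
  apply: prodr_ile1 => l _; case/andP: heps => e0 e1.
  by rewrite sum_F2 /F /mu /g /=; case: (l == i); nra.
rewrite (bigD1 i) //= sum_F2 /F /mu /g /= eqxx eq_sym (negPf ji).
by rewrite [X in X * _](_ : _ = 0) ?mul0r //; ring.
Qed.

Lemma wt_chebyshev n (w : R) : 0 < w ->
  prob eps (fun v : 'rV['F_2]_n => w < `|(wt v)%:R - eps * n%:R|)
    <= n%:R / w ^+ 2.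
Proof.
move=> w0; rewrite ler_pdivlMr ?exprn_gt0 //; apply: le_trans (wt_variance n).
rewrite /prob mulr_suml big_mkcond; apply: ler_sum => v _.
case: ifPn => [wv|_]; last by rewrite mulr_ge0 ?Peps_ge0 ?sqr_ge0.
rewrite ler_wpM2l ?Peps_ge0 //.
by rewrite -[leRHS]real_normK ?num_real // ler_sqr ?nnegrE ?normr_ge0 // ltW.
Qed.

End Noise.
End Signs.

(** * Dual codes, information sets and automorphisms *)

Lemma dual_code (F : fieldType) (N : nat) (C : {vspace 'rV[F]_N}) :
  exists r (K : 'M[F]_(r, N)),
    [/\ (r + \dim C)%N = N, row_free K
      & forall y : 'rV_N, (y <= K)%MS <-> (forall c, c \in C -> y *m c^T = 0)].
Proof.
pose B := \matrix_(i < \dim C) (vbasis C)`_i.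
have mulB (u : 'rV_(\dim C)) : u *m B = \sum_i u 0 i *: (vbasis C)`_i.
  by rewrite mulmx_sum_row; apply: eq_bigr => i _; rewrite rowK.
have rkB : \rank B = \dim C.
  apply/eqP; apply: inj_row_free => u; rewrite mulB => uB0.
  have /freeP := basis_free (vbasisP C).
  by move=> /(_ (fun i => u 0 i) uB0) u0; apply/rowP => i; rewrite u0 mxE.
exists (\rank (kermx B^T)), (row_base (kermx B^T)); split.
- rewrite mxrank_ker mxrank_tr rkB subnK //.
  by have := dimvS (subvf C); rewrite dimvf /dim /= mul1n.
- exact: row_base_free.
move=> y; rewrite eq_row_base; split=> [/sub_kermxP yB c cC|yC].
  have -> : c = (\row_i coord (vbasis C) i c) *m B.
    rewrite mulB [LHS](coord_vbasis cC).
    by apply: eq_bigr => i _; rewrite mxE.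
  by rewrite trmx_mul mulmxA yB mul0mx.
apply/sub_kermxP/rowP => i; rewrite [RHS]mxE.
have /yC : (vbasis C)`_i \in C by rewrite vbasis_mem // mem_nth // size_tuple.
move/rowP/(_ 0); rewrite [RHS]mxE => <-.
by rewrite !mxE; apply: eq_bigr => j _; rewrite !mxE.
Qed.

(** The map [f] picks an information set: a codeword [u *m K] is determined by its entries there,
    and these are arbitrary. *)
Lemma row_free_colsub_unit (F : fieldType) (r N : nat) (K : 'M[F]_(r, N)) :
  row_free K -> exists f : 'I_r -> 'I_N, colsub f K \in unitmx.
Proof.
move=> Kfree; have Kfull : row_full K^T by rewrite /row_full mxrank_tr.
exists (fullrankfun Kfull); rewrite -unitmx_tr.
by rewrite trmx_mxsub fullrowsub_unit.
Qed.

Definition code_aut (N : nat) (C : {vspace 'rV['F_2]_N}) : {set 'S_N} :=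
  [set s : 'S_N | [forall v, (v \in C) ==> (col_perm s v \in C)]].

Lemma code_autP (N : nat) (C : {vspace 'rV['F_2]_N}) (s : 'S_N) :
  reflect (forall v, v \in C -> col_perm s v \in C) (s \in code_aut C).
Proof.
by rewrite inE; apply: (iffP forallP) => h v; apply/implyP; apply: h.
Qed.

(** Closure under products suffices by finiteness; inverses, needed in [code_aut_dual], then come
    for free. *)
Lemma code_aut_group_set N (C : {vspace 'rV['F_2]_N}) : group_set (code_aut C).
Proof.
apply/group_setP; split=> [|s t /code_autP sC /code_autP tC]; apply/code_autP => v vC.
  by rewrite col_perm1.
by rewrite col_permM sC ?tC.
Qed.

Canonical code_aut_group N (C : {vspace 'rV['F_2]_N}) :=
  Group (code_aut_group_set C).

Lemma sum_mulmx_unit (F : finFieldType) (V : nmodType) (r : nat) (M : 'M[F]_r)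
    (Phi : 'rV[F]_r -> V) :
  M \in unitmx -> \sum_u Phi (u *m M) = \sum_z Phi z.
Proof.
move=> Mu; rewrite [RHS](reindex (mulmx^~ M)) //=.
by exists (mulmx^~ (invmx M)) => u _; rewrite ?mulmxK ?mulmxKV.
Qed.

(** * The Hölder-type bound from transitivity *)

Section Holder.
Variables (R : realType) (N : nat) (C : {vspace 'rV['F_2]_N}).
Variables (r : nat) (K : 'M['F_2]_(r, N)).
Hypothesis Kfree : row_free K.
Hypothesis Kdual :
  forall y : 'rV_N, (y <= K)%MS <-> (forall c, c \in C -> y *m c^T = 0).

(** Permuting [y] by [s] and pairing with [c] amounts to pairing [y] with [c] permuted by the
    inverse of [s], which stays in [C]. So the dual is preserved, and a rank count makes [Q]
    invertible. *)
Lemma code_aut_dual (s : 'S_N) : s \in code_aut C ->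
  exists2 Q, Q \in unitmx & col_perm s K = Q *m K.
Proof.
move=> sC; have /submxP[Q sK] : (col_perm s K <= K)%MS.
  apply/row_subP => i; apply/Kdual => c cC.
  have -> : row i (col_perm s K) = col_perm s (row i K).
    by apply/rowP => j; rewrite !mxE.
  rewrite mul_col_perm -tr_col_perm; apply: (Kdual _).1 (row_sub _ _) _ _.
  by apply/code_autP => //; rewrite groupV.
exists Q => //; rewrite -row_free_unit.
have : \rank (col_perm s K) = r.
  by rewrite col_permE mxrankMfree ?(eqP Kfree) // row_free_unit unitmx_perm.
by rewrite sK => rQ; rewrite /row_free eqn_leq rank_leq_row -{1}rQ mxrankM_maxl.
Qed.

Variables (f : 'I_r -> 'I_N) (funit : colsub f K \in unitmx).

(** The entries of [u *m K] at the positions [s (f a)] form [u] times an invertible matrix, so they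
    run over all of F_2^r once and the sum factorises. *)
Lemma sum_information_set (psi : 'F_2 -> R) (s : 'S_N) : s \in code_aut C ->
  \sum_(u : 'rV_r) \prod_a psi ((u *m K) 0 (s (f a))) = (\sum_b psi b) ^+ r.
Proof.
move=> /code_aut_dual[Q Qu sK].
have Mu : Q *m colsub f K \in unitmx by rewrite unitmx_mul Qu.
rewrite -[in RHS](card_ord r) -prodr_const.
rewrite -(sum_rV_prod (fun _ => psi)) -[RHS](sum_mulmx_unit _ Mu).
apply: eq_bigr => u _; apply: eq_bigr => a _; congr psi.
rewrite mulmx_colsub -sK mulmx_colsub [RHS]mxE.
by rewrite !mxE; apply: eq_bigr => j _; rewrite !mxE.
Qed.

Hypothesis Ctrans : transitive_code C.
Hypothesis N0 : (0 < N)%N.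

(* By transitivity the images of an information set under the automorphism
   group cover all coordinates evenly, so AM-GM over the group applies. *)
Lemma transitive_dual_holder (phi psi : 'F_2 -> R) :
    (forall b, 0 <= phi b) -> (forall b, 0 <= psi b) ->
    (forall b, psi b ^+ r = phi b ^+ N) ->
  \sum_(u : 'rV_r) \prod_i phi ((u *m K) 0 i) <= (\sum_b psi b) ^+ r.
Proof.
move=> phi0 psi0 phipsi; set G := code_aut C.
have G0 : 0 < #|G|%:R :> R by rewrite ltr0n cardG_gt0.
pose E (y : 'rV['F_2]_N) (s : 'S_N) := \prod_a psi (y 0 (s (f a))).
have E0 y s : 0 <= E y s by apply: prodr_ge0.
(* The geometric mean of [E y s] over the group is the product of the [phi]. The orbit product [P j]
   does not depend on [j], since translating [s] by a group element moves any index to any other. *)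
have prodE (y : 'rV_N) : \prod_(s in G) E y s = (\prod_i phi (y 0 i)) ^+ #|G|.
  pose P (j : 'I_N) := \prod_(s in G) psi (y 0 (s j)).
  have P0 j : 0 <= P j by apply: prodr_ge0.
  have Pconst i j : P i = P j.
    have [h [hi hC]] := Ctrans i j.
    have hG : h \in G by apply/code_autP.
    rewrite /P (reindex_inj (mulgI h)) /=.
    by apply: eq_big => s; rewrite ?groupMl // => _; rewrite permM hi.
  have Pprod : \prod_j P j = (\prod_j psi (y 0 j)) ^+ #|G|.
    rewrite exchange_big -prodr_const; apply: eq_bigr => s _ /=.
    by rewrite [RHS](reindex_inj (@perm_inj _ s)).
  pose j0 := Ordinal N0.
  have PN j : P j ^+ N = (\prod_j psi (y 0 j)) ^+ #|G|.
    rewrite -Pprod -[in LHS](card_ord N) -prodr_const.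
    by apply: eq_bigr => i _; apply: Pconst.
  (* Both sides are nonnegative, so their [N]-th powers may be compared; there [PN] and the relation
     between [psi] and [phi] apply. *)
  apply/eqP; rewrite -(@eqrXn2 _ N) ?exprn_ge0 ?prodr_ge0 //; apply/eqP.
  rewrite exchange_big /= -prodrXl.
  under eq_bigr => a _ do rewrite -/(P (f a)) PN.
  rewrite prodr_const card_ord -!exprM mulnC [in RHS]mulnC [LHS]exprM [RHS]exprM.
  congr (_ ^+ _); rewrite -!prodrXl; exact: eq_bigr.
have AMGM (y : 'rV_N) : \prod_i phi (y 0 i) <= (\sum_(s in G) E y s) / #|G|%:R.
  have mu0 : 0 <= (\sum_(s in G) E y s) / #|G|%:R.
    by rewrite divr_ge0 ?(ltW G0) // sumr_ge0.
  have ph0 : 0 <= \prod_i phi (y 0 i) by apply: prodr_ge0.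
  rewrite -(@ler_pXn2r _ #|G|) ?nnegrE ?cardG_gt0 // -prodE.
  exact: (leif_AGM (A := mem G) (fun s _ => E0 y s)).1.
apply: (@le_trans _ _ (\sum_(u : 'rV_r) (\sum_(s in G) E (u *m K) s) / #|G|%:R)).
  by apply: ler_sum => u _; apply: AMGM.
rewrite -mulr_suml exchange_big /=.
under eq_bigr => s sG do rewrite sum_information_set //.
by rewrite sumr_const -(mulr_natr (_ ^+ r)) mulfK // gt_eqF.
Qed.

End Holder.

(** * The collision sum of a transitive code *)

Lemma transitive_collision (R : realType) (eta q : R) (N : nat)
    (C : {vspace 'rV['F_2]_N}) :
    0 < eta -> eta < 1 -> 0 <= q < 1 -> (0 < N)%N ->
    transitive_code C -> (\dim C)%:R = eta * N%:R ->
  \sum_(v : 'rV_N) \sum_(c in C) q ^+ wt v * q ^+ wt (v + c)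
    <= (1 + (1 + eta) / (1 - eta) * q ^+ 2) ^+ N.
Proof.
move=> eta0 eta1 /andP[q0 q1] N0 Ctrans dimC.
have [r [K [rN Kfree Kdual]]] := dual_code C.
have [f funit] := row_free_colsub_unit Kfree.
have rR : r%:R = (1 - eta) * N%:R :> R.
  have : r%:R + (\dim C)%:R = N%:R :> R by rewrite -natrD rN.
  by rewrite dimC mulrBl mul1r => /(canRL (addrK _)).
have card2 : #|'rV['F_2]_r|%:R = 2 ^+ r :> R.
  by rewrite card_mx mul1n card_Fp // natrX.
have chi_dual (c : 'rV_N) (u : 'rV_r) : c \in C -> chi R c (u *m K) = 1.
  move=> cC; have uK0 := (Kdual _).1 (submxMl u K) c cC.
  by rewrite /chi -[_ *m _]trmxK trmx_mul trmxK uK0 mxE mxE /sgF2 eqxx.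
have chi2 (v y : 'rV_N) : chi R v y * chi R v y = 1.
  by rewrite /chi /sgF2; case: eqP; rewrite ?mulr1 ?mulrNN ?mulr1.
(* After scaling by the size 2^r of the dual, the indicator of [C] is dominated by the character sum
   over the dual: it equals 2^r on [C] and is nonnegative elsewhere. *)
rewrite -(ler_pM2l (x := 2 ^+ r)) ?exprn_gt0 //.
apply: (@le_trans _ _ (\sum_(v : 'rV_N) \sum_(c : 'rV_N)
    (q ^+ wt v * q ^+ wt (v + c)) * \sum_(u : 'rV_r) chi R c (u *m K))).
  rewrite mulr_sumr; apply: ler_sum => v _.
  rewrite mulr_sumr big_mkcond; apply: ler_sum => c _ /=.
  have qq : 0 <= q ^+ wt v * q ^+ wt (v + c) by rewrite mulr_ge0 ?exprn_ge0.
  case: ifPn => [cC|_]; last by rewrite mulr_ge0 ?sum_chi_ge0.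
  under eq_bigr => u _ do rewrite chi_dual //.
  by rewrite sumr_const card2 mulrC.
(* Substituting v + c for the second word splits the character as chi(c) = chi(v) chi(v + c), and
   the double sum becomes the square of a Fourier transform. *)
have -> : \sum_(v : 'rV_N) \sum_(c : 'rV_N)
    (q ^+ wt v * q ^+ wt (v + c)) * (\sum_(u : 'rV_r) chi R c (u *m K)) =
    \sum_(u : 'rV_r) \prod_i (1 + q * sgF2 R ((u *m K) 0 i)) ^+ 2.
  under eq_bigr => v _ do under eq_bigr => c _ do rewrite mulr_sumr.
  under eq_bigr => v _ do rewrite exchange_big /=.
  rewrite exchange_big; apply: eq_bigr => u _ /=.
  rewrite prodrXl -sum_expr_wt_chi expr2 mulr_suml; apply: eq_bigr => v _.
  rewrite mulr_sumr [RHS](reindex_inj (addrI v)) /=; apply: eq_bigr => c _.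
  rewrite chiD mulrACA [X in _ = _ * X]mulrA chi2 mul1r //.
(* This is 2N/r, the exponent for which [psi ^+ r = phi ^+ N]. *)
pose a : R := 2 / (1 - eta).
have eta_lt : 0 < 1 - eta by lra.
have etan : 1 - eta != 0 by rewrite gt_eqF.
have a2 : 2 <= a by rewrite ler_pdivlMr //; lra.
have qsg b : 0 < 1 + q * sgF2 R b by rewrite /sgF2; case: ifP => _; lra.
apply: le_trans (transitive_dual_holder Kfree Kdual funit Ctrans N0
  (phi := fun b => (1 + q * sgF2 R b) ^+ 2)
  (psi := fun b => (1 + q * sgF2 R b) `^ a) _ _ _) _.
- by move=> b; apply: sqr_ge0.
- by move=> b; apply: powR_ge0.
- move=> b; rewrite -exprM -!powR_mulrn ?powR_ge0 ?ltW // -powRrM.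
  by congr (_ `^ _); rewrite rR natrM /a; field.
have q01 : 0 <= q < 1 by rewrite q0.
have := two_point_le a2 q01.
rewrite sum_F2 /sgF2 /= mulr1 mulrN1.
set S := _ `^ a + _ => SV.
have S0 : 0 <= S by rewrite addr_ge0 ?powR_ge0.
(* The scaling 2^r is spent on turning each sum over a bit into an average. *)
have -> : S ^+ r = 2 ^+ r * (S / 2) ^+ r by rewrite -exprMn mulrC divfK.
rewrite ler_pM2l ?exprn_gt0 //.
have V0 : 0 <= 1 + (a - 1) * q ^+ 2 by rewrite addr_ge0 ?mulr_ge0 ?sqr_ge0; lra.
have -> : (1 + eta) / (1 - eta) = a - 1 by rewrite /a; field.
set V := 1 + _ in SV V0 *.
apply: le_trans (lerXn2r r _ _ SV) _; rewrite ?nnegrE ?powR_ge0 ?divr_ge0 //.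
rewrite -!powR_mulrn ?powR_ge0 // -powRrM (_ : a / 2 * r%:R = N%:R) //.
by rewrite rR /a; field.
Qed.

(** * The list decoder and its failure probability *)

Definition typical_list (R : realType) (eps w k : R) (N : nat)
    (C : {vspace 'rV['F_2]_N}) (x : 'rV['F_2]_N) : {set 'rV['F_2]_N} :=
  let L := [set c in C | `|(wt (x - c))%:R - eps * N%:R| <= w] in
  if #|L|%:R <= k then L else finset.set0.

(** Failure means either noise of atypical weight, handled by Chebyshev, or typical noise with more
    than [k] competing codewords, handled by Markov and [transitive_collision]. *)
Lemma typical_list_fail (R : realType) (eps eta w k q : R) (N : nat)
    (C : {vspace 'rV['F_2]_N}) (c : 'rV['F_2]_N) :
    0 < eps -> eps < 1 -> 0 < eta -> eta < 1 -> 0 < w -> 0 < k ->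
    0 < q -> q < 1 -> (1 + eta) / (1 - eta) * q ^+ 2 = eps / (1 - eps) ->
    (0 < N)%N -> transitive_code C -> (\dim C)%:R = eta * N%:R -> c \in C ->
  prob eps (fun rho => c \notin typical_list eps w k C (c + rho)) <=
    N%:R / w ^+ 2 +
    ((1 + eta) / (1 - eta)) `^ (eps * N%:R + w) * q `^ (- (2 * w)) / k.
Proof.
move=> e0 e1 eta0 eta1 w0 k0 q0 q1 qE N0 Ctrans dimC cC.
have heps : 0 <= eps <= 1 by rewrite !ltW.
set A := (1 + eta) / (1 - eta) in qE *.
have A1 : 1 <= A by rewrite /A ler_pdivlMr; lra.
pose win (v : 'rV['F_2]_N) := `|(wt v)%:R - eps * N%:R| <= w.
pose L (rho : 'rV['F_2]_N) : R := \sum_(c' in C | win (rho + c')) 1.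
have cardL rho : #|[set c' in C | win (c + rho - c')]|%:R = L rho.
  rewrite -sum1_card natr_sum /L.
  (* Recentring at the sent word makes the list size depend on the noise only. *)
  rewrite (reindex_inj (h := fun c' => c - c')) /=; last by move=> x y /addrI/oppr_inj.
  apply: eq_bigl => c'; rewrite inE; congr (_ && win _).
    by apply/idP/idP => [h|]; [rewrite -[c'](subKr c) memvB|apply: memvB].
  by rewrite opprB addrC addrA subrK addrC.
have notinT rho : c \notin typical_list eps w k C (c + rho) ->
    (w < `|(wt rho)%:R - eps * N%:R|) || (win rho && (k < L rho)).
  rewrite -(cardL rho) /typical_list /win /=.
  case: ifPn => [_|]; last by rewrite -ltNge => -> _; rewrite andbT; case: ltP.
  by rewrite inE cC /= addrAC subrr add0r -ltNge => ->.
have tail := wt_chebyshev heps N w0.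
have many : \sum_(rho | win rho && (k < L rho)) Peps eps rho <=
    A `^ (eps * N%:R + w) * q `^ (- (2 * w)) / k.
  (* By the choice of [q], the noise probability is (1-eps)^N A^wt q^(2 wt). Typicality bounds A^wt,
     and replacing one weight of [rho] by that of [rho + c'] costs at most q^(-2w), both being
     within [w] of the mean. *)
  pose B := (1 - eps) ^+ N * A `^ (eps * N%:R + w) * q `^ (- (2 * w)).
  have PB (rho c' : 'rV['F_2]_N) : win rho -> win (rho + c') ->
      Peps eps rho <= B * (q ^+ wt rho * q ^+ wt (rho + c')).
    rewrite /win !ler_distl => /andP[w1 w2] /andP[_ w3].
    have wtN : (wt rho <= N)%N by rewrite -[leqRHS]card_ord max_card.
    have -> : Peps eps rho = (1 - eps) ^+ N * A ^+ wt rho * (q ^+ wt rho * q ^+ wt rho).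
      have -> : (1 - eps) ^+ N = (1 - eps) ^+ wt rho * (1 - eps) ^+ (N - wt rho).
        by rewrite -exprD subnKC.
      rewrite -mulrA -!exprMn -expr2 qE expr_div_n /Peps.
      by field; rewrite expf_neq0 // gt_eqF ?subr_gt0.
    rewrite /B -!mulrA ler_pM2l ?exprn_gt0 ?subr_gt0 //.
    have A0 : 0 <= A by lra.
    have q0' := ltW q0.
    apply: ler_pM; rewrite ?mulr_ge0 ?exprn_ge0 //.
      by rewrite -powR_mulrn //; apply: ler_powR => //; lra.
    rewrite mulrCA ler_pM2l ?exprn_gt0 // -!powR_mulrn //.
    rewrite -powRD; last by rewrite (gt_eqF q0) implybT.
    by apply: ger_powR; [rewrite q0 ltW|lra].
  rewrite ler_pdivlMr // mulr_suml.
  (* The collision bound is exactly (1-eps)^(-N), cancelling the first factor of [B]. *)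
  apply: (@le_trans _ _ (B * (1 + A * q ^+ 2) ^+ N)); last first.
    rewrite qE /B (_ : 1 + eps / (1 - eps) = (1 - eps)^-1); last first.
      by field; rewrite gt_eqF ?subr_gt0.
    by rewrite exprVn -[X in X / _]mulrA [leLHS]mulrC mulKf //
      expf_neq0 ?gt_eqF ?subr_gt0.
  have q01 : 0 <= q < 1 by rewrite ltW.
  have B0 : 0 <= B by rewrite !mulr_ge0 ?powR_ge0 ?exprn_ge0 //; lra.
  apply: le_trans (ler_wpM2l B0 (transitive_collision eta0 eta1 q01 N0 Ctrans dimC)).
  rewrite mulr_sumr big_mkcond; apply: ler_sum => rho _ /=.
  have qq c' : 0 <= q ^+ wt rho * q ^+ wt (rho + c').
    by rewrite mulr_ge0 ?exprn_ge0 ?ltW.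
  case: ifPn => [/andP[wrho kL]|_]; last by rewrite mulr_ge0 ?sumr_ge0.
  apply: (@le_trans _ _ (Peps eps rho * L rho)).
    by rewrite ler_wpM2l ?Peps_ge0 // ltW.
  rewrite /L !mulr_sumr big_mkcondr /=; apply: ler_sum => c' _.
  case: ifPn => [wc|_]; last by rewrite mulr_ge0.
  by rewrite mulr1 PB.
apply: (le_trans _ (lerD tail many)); rewrite /prob.
rewrite [leLHS]big_mkcond [X in X + _]big_mkcond [X in _ + X]big_mkcond -big_split /=.
apply: ler_sum => rho _; have P0 := Peps_ge0 heps rho.
case: ifPn => [/notinT/orP[->|->]|_]; last by rewrite addr_ge0 //; case: ifP.
  by rewrite lerDl; case: ifP.
by rewrite lerDr; case: ifP.
Qed.

(** * Growth of the window width *)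

Section Scale.
Variable R : realType.

(** The cube of this scale is the window width: above sqrt N for Chebyshev, yet o(N). The shift to N
    + 1 keeps it at least 1 even for [N = 0]. *)
Definition root4 (N : nat) : R := Num.sqrt (Num.sqrt N.+1%:R).

Lemma root4_exp4 N : root4 N ^+ 4 = N.+1%:R.
Proof. by rewrite (exprM _ 2 2) !sqr_sqrtr ?sqrtr_ge0. Qed.

Lemma root4_ge1 N : 1 <= root4 N.
Proof. by rewrite -[leLHS]sqrtr1 ler_sqrt // -[leLHS]sqrtr1 ler_sqrt // ler1n. Qed.

Lemma root4_gt0 N : 0 < root4 N.
Proof. by rewrite (lt_le_trans ltr01) ?root4_ge1. Qed.

Lemma near_le_root4 (M : R) : \forall N \near \oo, M <= root4 N.
Proof.
near=> N; case: (leP M 0) => [M0|M0]; first exact: le_trans M0 (ltW (root4_gt0 N)).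
rewrite -(@ler_pXn2r _ 4) ?nnegrE ?(ltW (root4_gt0 _)) ?(ltW M0) // root4_exp4.
have MN : M ^+ 4 <= N%:R by near: N; exact: nbhs_infty_ger.
by rewrite (le_trans MN) // ler_nat.
Unshelve. all: by end_near. Qed.

Lemma root4_exp3_littleo (a : R) :
  (fun N => root4 N ^+ 3 * a) =o_\oo (fun N : nat => N%:R : R).
Proof.
apply/eqoP => e e0; near=> N.
have N1 : 1 <= N%:R :> R by near: N; exact: nbhs_infty_ger.
have aN : 2 * `|a| / e <= root4 N by near: N; exact: near_le_root4.
have t0 := root4_gt0 N; have t4 := root4_exp4 N.
rewrite normrM (ger0_norm (exprn_ge0 3 (ltW t0))) (ger0_norm (ler0n R N)).
rewrite -(ler_pM2l t0) mulrA -exprS t4.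
move: aN; rewrite ler_pdivrMr // => aN.
have : N%:R * (2 * `|a|) <= N%:R * (root4 N * e) by rewrite ler_wpM2l.
have : N.+1%:R * `|a| <= (2 * N%:R) * `|a|.
  by rewrite ler_wpM2r // -natr1; lra.
lra.
Unshelve. all: by end_near. Qed.

Lemma root4_inv_cvg0 (a : R) : (fun N => a / root4 N) @ \oo --> (0 : R).
Proof.
apply/cvgrPdist_le => e e0; near=> N.
have aN : `|a| / e <= root4 N by near: N; exact: near_le_root4.
rewrite sub0r normrN normrM normfV (ger0_norm (ltW (root4_gt0 N))).
by rewrite ler_pdivrMr ?root4_gt0 // mulrC -ler_pdivrMr.
Unshelve. all: by end_near. Qed.

End Scale.

(** * Choice of parameters and conclusion *)

Theorem theorem1p5 (R : realType) (eps eta : R)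
    (heps0 : 0 < eps) (heps1 : eps < 1 / 2)
    (heta0 : 0 < eta) (heta1 : eta < 1) :
  exists k p : nat -> R,
    [/\ exists o1 o2 : nat -> R,
          [/\ o1 =o_\oo (fun N : nat => N%:R : R),
              o2 =o_\oo (fun N : nat => N%:R : R)
            & forall N : nat,
                k N = 2 `^ (eps * N%:R * log2 (2 / (1 - eta)) + o1 N)
                      + 2 `^ (4 * eps * N%:R + o2 N)],
        p @ \oo --> (0 : R)
      & forall (N : nat) (C : {vspace 'rV['F_2]_N}),
          transitive_code C ->
          (\dim C)%:R = eta * N%:R ->
          exists T : 'rV['F_2]_N -> {set 'rV['F_2]_N},
            [/\ forall x c : 'rV['F_2]_N, c \in T x -> c \in C,
                forall x : 'rV['F_2]_N, (#|T x|)%:R <= k N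
              & forall c : 'rV['F_2]_N, c \in C ->
                  prob eps (fun rho => c \notin T (c + rho)) <= p N]].

Proof.
have eta_lt : 0 < 1 - eta by lra.
have eps_lt : 0 < 1 - eps by lra.
pose A := (1 + eta) / (1 - eta).
have A0 : 0 < A by rewrite divr_gt0 //; lra.
have A1 : 1 <= A by rewrite ler_pdivlMr //; lra.
have Q0 : 0 < eps / (1 - eps) / A by rewrite divr_gt0 // divr_gt0.
pose q := Num.sqrt (eps / (1 - eps) / A).
have q0 : 0 < q by rewrite sqrtr_gt0.
have q2 : q ^+ 2 = eps / (1 - eps) / A by rewrite sqr_sqrtr // ltW.
(* Here [eps < 1 / 2] enters: eps/(1-eps) < 1 <= A. *)
have q1 : q < 1.
  rewrite -(@ltr_pXn2r _ 2) ?nnegrE ?ltW // q2 expr1n !ltr_pdivrMr // mul1r.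
  by nra.
have qE : A * q ^+ 2 = eps / (1 - eps) by rewrite q2 mulrC divfK // gt_eqF.
pose w N : R := root4 R N ^+ 3.
(* Per unit of [w]: ln A pays for the excess weight, -2 ln q for exchanging the two weights, and 1
   gives a spare factor e^w that makes the Markov term small. *)
pose kappa := ln A - 2 * ln q + 1.
have ln2 : 0 < ln 2 :> R by rewrite ln_gt0 // ltr1n.
pose o1 N := w N * (kappa / ln 2).
pose k N := 2 `^ (eps * N%:R * log2 (2 / (1 - eta)) + o1 N)
  + 2 `^ (4 * eps * N%:R + 0).
exists k, (fun N => 2 / root4 R N); split.
- exists o1, (fun=> 0); split => //; first exact: root4_exp3_littleo.
  by apply/eqoP => e e0; near=> N; rewrite normr0 mulr_ge0 // ltW.
- exact: root4_inv_cvg0.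
move=> N C Ctrans dimC.
have t0 := root4_gt0 R N; have t1 := root4_ge1 R N; have t4 := root4_exp4 R N.
have k0 : 0 < k N by rewrite addr_gt0 // powR_gt0.
have w0 : 0 < w N by rewrite exprn_gt0.
exists (typical_list eps (w N) (k N) C); split.
- move=> x c; rewrite /typical_list; case: ifP => _; rewrite inE //.
  by case/andP.
- move=> x; rewrite /typical_list; case: ifP => // _.
  by rewrite cards0 ltW.
(* For [N = 0] the claimed bound is 2, so total mass 1 suffices. *)
move=> c cC; have [N0|N0] := posnP N.
  have : prob eps (fun rho => c \notin typical_list eps (w N) (k N) C (c + rho)) <= 1.
    rewrite -(Peps_sum1 eps N) /prob big_mkcond; apply: ler_sum => rho _.
    by case: ifP => // _; apply: Peps_ge0; lra.
  move=> /le_trans; apply; rewrite ler_pdivlMr // mul1r.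
  have : root4 R N = 1 by rewrite /root4 N0 !sqrtr1.
  by move=> ->; rewrite ler1n.
have eps1 : eps < 1 by lra.
apply: le_trans (typical_list_fail heps0 eps1 heta0 heta1 w0 k0 q0 q1 qE N0
  Ctrans dimC cC) _.
(* One half of the error budget goes to Chebyshev, the other to Markov. With t = [root4 R N], the
   first is N/t^6 <= 1/t. *)
rewrite (_ : 2 / root4 R N = (root4 R N)^-1 + (root4 R N)^-1); last first.
  by field; rewrite gt_eqF.
apply: lerD.
  rewrite ler_pdivrMr ?exprn_gt0 // /w -exprM.
  rewrite (_ : (3 * 2)%N = (1 + 5)%N) // exprD expr1 mulKf ?gt_eqF //.
  rewrite exprSr t4; apply: le_trans (_ : N.+1%:R <= _); first by rewrite ler_nat.
  by rewrite ler_peMr.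
rewrite ler_pdivrMr // [leRHS]mulrC ler_pdivlMr //.
have two0 : (2 : R) != 0 by rewrite pnatr_eq0.
apply: (@le_trans _ _ (2 `^ (eps * N%:R * log2 (2 / (1 - eta)) + o1 N))); last first.
  by rewrite lerDl powR_ge0.
rewrite /powR (negPf two0) !gt_eqF //.
(* The spare factor absorbs [root4], since t <= t^3 = w <= e^w. *)
apply: (@le_trans _ _ (expR ((eps * N%:R + w N) * ln A) *
  expR (- (2 * w N) * ln q) * expR (w N))).
  rewrite ler_wpM2l ?mulr_ge0 ?expR_ge0 //.
  apply: le_trans (expR_ge1Dx _); rewrite /w -[leLHS]add0r lerD //.
  by rewrite exprS ler_peMr ?exprn_ege1 // ltW.
rewrite -!expRD ler_expR.
have lnA : ln A <= ln (2 / (1 - eta)).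
  have AB : A <= 2 / (1 - eta) by rewrite /A ler_pM2r ?invr_gt0 //; lra.
  by rewrite ler_ln ?posrE // divr_gt0.
have -> : (eps * N%:R * log2 (2 / (1 - eta)) + o1 N) * ln 2 =
    eps * N%:R * ln (2 / (1 - eta)) + w N * kappa.
  by rewrite /log2 /o1; field; rewrite gt_eqF.
have : eps * N%:R * ln A <= eps * N%:R * ln (2 / (1 - eta)).
  by rewrite ler_wpM2l // mulr_ge0 // ltW.
by rewrite /kappa; lra.
Unshelve. all: by end_near. Qed.
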